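(* Let $\Gamma$ be an arithmetic subgroup of congruence type, $k,\ell\ge0$ integers and $m\in\mathbb Z$. Then the set $\{P_f : f\in\widetilde W^{\,\le\ell}_{k,m}(\Gamma)\}$ of associated polynomials equals $\mathcal{WP}^{\,\le\ell}_{k,m}(\Gamma)$. Moreover, if $P(z,X)=\sum_{i=0}^\ell\alpha_i(z)X^i\in\mathcal{WP}^{\,\le\ell}_{k,m}(\Gamma)$, then $\alpha_0\in \widetilde W^{\,\le\ell}_{k,m}(\Gamma)$ and $P=P_{\alpha_0}$.
   Context: Let $K$ be a global function field with constant field $\mathbb F_q$, $\infty$ a fixed place, $A$ the ring of functions regular outside $\infty$, $K_\infty$ the completion at $\infty$, $\mathbb C_\infty$ the completion of an algebraic closure of $K_\infty$, $\Omega=\mathbb P^1(\mathbb C_\infty)\setminus\mathbb P^1(K_\infty)$ with $\mathrm{GL}_2(K_\infty)$ acting by $\gamma z=\frac{az+b}{cz+d}$ for $\gamma=\begin{pmatrix}a&b\\c&d\end{pmatrix}$. For $k,m\in\mathbb Z$, $(f|_{k,m}\gamma)(z)=(\det\gamma)^m(cz+d)^{-k}f(\gamma z)$. An arithmetic subgroup of congruence type is a subgroup $\Gamma\subseteq\mathrm{GL}_2(K)$ commensurable with $\mathrm{GL}_2(A)$ containing some $\Gamma(\mathfrak n)=\{\gamma\in\mathrm{GL}_2(A):\gamma\equiv1\bmod\mathfrak n\}$. $\mathcal O$ = rigid analytic $h:\Omega\to\mathbb C_\infty$ invariant under translation by some nonzero ideal of $A$. $f$ is a quasi-modular function of weight $k\ge0$,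 type $m$, depth $\ell\ge0$ for $\Gamma$ if there exist $f_0,\dots,f_\ell\in\mathcal O$, $f_\ell\ne0$, with $(f|_{k,m}\gamma)(z)=\sum_{i=0}^\ell f_i(z)(\frac{c}{cz+d})^i$ for all $z\in\Omega,\gamma\in\Gamma$ ($0$ counts, depth 0); $\widetilde W^{\,\le\ell}_{k,m}(\Gamma)$ is the space of those of depth $\le\ell$; the $f_i$ are unique and $P_f=\sum f_iX^i\in\mathcal O[X]$ is the associated polynomial ($P_0=0$). For $P(z,X)\in\mathcal O[X]$ and $\gamma\in\mathrm{GL}_2(K_\infty)$ define $(P||_{k,m}\gamma)(z,X)=(\det\gamma)^m(cz+d)^{-k}P\!\left(\gamma z,\frac{(cz+d)^2}{\det\gamma}\big(X-\frac{c}{cz+d}\big)\right)$. $\mathcal{WP}^{\,\le\ell}_{k,m}(\Gamma)$ is the set of $P\in\mathcal O[X]$ of degree at most $\ell$ (including $0$) with $(P||_{k,m}\gamma)(z,X)=P(z,X)$ for all $\gamma\in\Gamma$, $z\in\Omega$ (weakly quasi-modular polynomials). *)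

(* Defs.v *)
From HB Require Import structures.
From mathcomp Require Import all_boot all_order all_algebra all_field.
From mathcomp Require Import fraction.
From mathcomp Require Import boolp classical_sets functions cardinality reals.

Set Implicit Arguments.
Unset Strict Implicit.
Unset Printing Implicit Defensive.

Import Order.TTheory GRing.Theory Num.Theory.
Local Open Scope ring_scope.
Local Open Scope classical_set_scope.

(* A global function field is presented as a finite extension K of the
   rational function field F(T) over a finite field F. *)
Section FunctionField.
Context (F : finFieldType) (K : fieldExtType {fraction {poly F}}).

Definition const_emb (c : F) : K := (tofrac c%:P)%:A.

Definition constant_field_is_base : Prop :=
  forall x : K, algebraicOver const_emb x -> exists c : F, x = const_emb c.

(* A place is identified with its normalized valuation, i.e. the one with value
   group Z.  The value at 0, mathematically +oo, is set to 0, so that distinct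
   functions satisfying is_place are distinct places, and so that the condition
   [0 <= v x] correctly holds at x = 0. *)
Record is_place (v : K -> int) : Prop := IsPlace {
  place0 : v 0 = 0;
  placeM : forall x y : K, x != 0 -> y != 0 -> v (x * y) = v x + v y;
  placeD : forall x y : K, x != 0 -> y != 0 -> x + y != 0 ->
    Num.min (v x) (v y) <= v (x + y);
  place_onto : forall n : int, exists2 x : K, x != 0 & v x = n
}.

Definition regular_outside (v : K -> int) : set K :=
  [set x | forall w, is_place w -> w <> v -> 0 <= w x].

(* The absolute value q ^ (- v x).  Some authors use q ^ (- deg v * v x); this is
   a power of the present one and defines the same completion. *)
Definition place_abs (R : realType) (v : K -> int) (x : K) : R :=
  if x == 0 then 0 else (#|F|%:R : R) ^ (- v x).

End FunctionField.

Section CongruenceSubgroups.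
Context (K : fieldType) (A : set K).

Definition is_ideal (n : set K) : Prop :=
  [/\ n `<=` A, n 0, (forall x y, n x -> n y -> n (x + y))
    & (forall a x, A a -> n x -> n (a * x))].

Definition is_nonzero_ideal (n : set K) : Prop :=
  is_ideal n /\ exists2 x, n x & x != 0.

Definition GL2 : set 'M[K]_2 :=
  [set g | [/\ g \in unitmx, (forall i j, A (g i j)) & A (\det g)^-1]].

Definition principal_congruence (n : set K) : set 'M[K]_2 :=
  [set g | GL2 g /\ forall i j, n ((g - 1%:M) i j)].

Definition is_subgroup (G : set 'M[K]_2) : Prop :=
  [/\ (forall g, G g -> g \in unitmx), G 1%:M,
      (forall g h, G g -> G h -> G (g *m h))
    & (forall g, G g -> G (invmx g))].

Definition finite_index (H G : set 'M[K]_2) : Prop :=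
  finite_set [set [set h *m g | h in H] | g in G].

Definition commensurable (G H : set 'M[K]_2) : Prop :=
  finite_index (G `&` H) G /\ finite_index (G `&` H) H.

Definition arithmetic_congruence (G : set 'M[K]_2) : Prop :=
  [/\ is_subgroup G, commensurable G GL2
    & exists2 n, is_nonzero_ideal n & principal_congruence n `<=` G].

End CongruenceSubgroups.

Section AbsoluteValues.
Context (R : realType).

Record nonarch_abs (k : fieldType) (abs : k -> R) : Prop := NonarchAbs {
  nabs_ge0 : forall x, 0 <= abs x;
  nabs_eq0 : forall x, abs x = 0 <-> x = 0;
  nabsM : forall x y, abs (x * y) = abs x * abs y;
  nabsD : forall x y, abs (x + y) <= Num.max (abs x) (abs y)
}.

Definition complete_abs (k : fieldType) (abs : k -> R) : Prop :=
  forall u : nat -> k,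
    (forall e, 0 < e -> exists N, forall i j, (N <= i)%N -> (N <= j)%N ->
       abs (u i - u j) < e) ->
    exists l, forall e, 0 < e -> exists N, forall i, (N <= i)%N ->
       abs (u i - l) < e.

Record is_completion (k k' : fieldType) (abs : k -> R) (abs' : k' -> R)
    (i : {rmorphism k -> k'}) : Prop := IsCompletion {
  completion_abs : nonarch_abs abs';
  completion_ext : forall x, abs' (i x) = abs x;
  completion_dense : forall y e, 0 < e -> exists x, abs' (y - i x) < e;
  completion_complete : complete_abs abs'
}.

End AbsoluteValues.

Definition is_algebraic_closure (k L : fieldType) (i : {rmorphism k -> L}) :=
  GRing.closed_field_axiom L /\ forall y : L, algebraicOver i y.

(* The tower K -> K_oo -> algebraic closure of K_oo -> C_oo.  Each stage is given
   by the property that determines it up to a unique (completions), resp. up to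
   some (algebraic closure), isometric isomorphism. *)
Record Coo_tower (R : realType) (F : finFieldType)
    (K : fieldExtType {fraction {poly F}}) (v : K -> int) := CooTower {
  Koo : fieldType;
  Koo_abs : Koo -> R;
  Koo_emb : {rmorphism K -> Koo};
  Koo_completion : is_completion (@place_abs F K R v) Koo_abs Koo_emb;
  Kbar : fieldType;
  Kbar_abs : Kbar -> R;
  Kbar_emb : {rmorphism Koo -> Kbar};
  Kbar_closure : is_algebraic_closure Kbar_emb;
  Kbar_nonarch : nonarch_abs Kbar_abs;
  Kbar_ext : forall x, Kbar_abs (Kbar_emb x) = Koo_abs x;
  Coo : fieldType;
  Coo_abs : Coo -> R;
  Coo_emb : {rmorphism Kbar -> Coo};
  Coo_completion : is_completion Kbar_abs Coo_abs Coo_emb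
}.

Section DrinfeldHalfPlane.
Context (R : realType) (F : finFieldType) (K : fieldExtType {fraction {poly F}}).
Context (v : K -> int) (T : Coo_tower R v).

Local Notation A := (regular_outside v).
Local Notation C := (Coo T).

Definition Koo_in (x : Koo T) : C := Coo_emb T (Kbar_emb T x).

Definition K_in (x : K) : C := Koo_in (Koo_emb T x).

(* The point at infinity lies in P^1(K_oo), so P^1(C_oo) \ P^1(K_oo) is the affine
   set C_oo \ K_oo. *)
Definition in_Omega : pred C := fun z => `[< ~ range Koo_in z >].

Record Omega := MkOmega { Omega_val : C; _ : in_Omega Omega_val }.
HB.instance Definition _ := [isSub of Omega for Omega_val].

Definition autfac (g : 'M[Koo T]_2) (z : C) : C :=
  Koo_in (g 1 0) * z + Koo_in (g 1 1).

Definition cfrac (g : 'M[Koo T]_2) (z : C) : C :=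
  Koo_in (g 1 0) / autfac g z.

Definition mobius_val (g : 'M[Koo T]_2) (z : C) : C :=
  (Koo_in (g 0 0) * z + Koo_in (g 0 1)) / autfac g z.

(* The default value z is used only for singular g, see mobiusE. *)
Definition mobius (g : 'M[Koo T]_2) (z : Omega) : Omega :=
  insubd z (mobius_val g (val z)).

(* The admissible covering of Omega by the affinoids
   Omega_n = {z : |z| <= q^n and |z - x| >= q^-n for all x in K_oo}. *)
Definition affinoid (n : nat) : set Omega :=
  [set z | Coo_abs (val z) <= #|F|%:R ^+ n /\
    forall x : Koo T, #|F|%:R ^- n <= Coo_abs (val z - Koo_in x)].

Definition rigid_analytic (h : Omega -> C) : Prop :=
  forall (n : nat) (e : R), 0 < e -> exists p s : {poly C},
    forall z, affinoid n z ->
      s.[val z] != 0 /\ Coo_abs (h z - p.[val z] / s.[val z]) <= e.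

Definition calO : set (Omega -> C) :=
  [set h | rigid_analytic h /\
    exists2 n, is_nonzero_ideal A n &
      forall a, n a -> forall z w : Omega, val w = val z + K_in a -> h w = h z].

(* A polynomial over calO is represented by the function z |-> P(z, X), with
   coefficients in calO and degrees bounded uniformly in z. *)
Definition calOX : set (Omega -> {poly C}) :=
  [set P | (forall i, calO (fun z => (P z)`_i)) /\
           exists N, forall z, (size (P z) <= N)%N].

Definition slash (k m : int) (f : Omega -> C) (g : 'M[Koo T]_2) : Omega -> C :=
  fun z => Koo_in (\det g) ^ m * autfac g (val z) ^ (- k) * f (mobius g z).

Definition pslash (k m : int) (P : Omega -> {poly C}) (g : 'M[Koo T]_2) :
    Omega -> {poly C} :=
  fun z => (Koo_in (\det g) ^ m * autfac g (val z) ^ (- k)) *: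
    (P (mobius g z) \Po
      ((autfac g (val z) ^+ 2 / Koo_in (\det g)) *: ('X - (cfrac g (val z))%:P))).

Definition toKoo (g : 'M[K]_2) : 'M[Koo T]_2 := map_mx (Koo_emb T) g.

Section QuasiModular.
Context (G : set 'M[K]_2) (k m : int).

Definition quasi_modular_depth (l : nat) (f : Omega -> C) : Prop :=
  exists fs : 'I_l.+1 -> Omega -> C,
    [/\ forall i, calO (fs i), fs ord_max <> (fun=> 0)
      & forall g, G g -> forall z,
          slash k m f (toKoo g) z =
          \sum_(i < l.+1) fs i z * cfrac (toKoo g) (val z) ^+ i].

Definition quasi_modular (l : nat) : set (Omega -> C) :=
  [set f | f = (fun=> 0) \/ exists2 j, (j <= l)%N & quasi_modular_depth j f].

Definition is_assoc_poly (f : Omega -> C) (P : Omega -> {poly C}) : Prop :=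
  calOX P /\ forall g, G g -> forall z,
    slash k m f (toKoo g) z = (P z).[cfrac (toKoo g) (val z)].

Definition assoc_poly (f : Omega -> C) : Omega -> {poly C} :=
  xget (fun=> 0) [set P | is_assoc_poly f P].

Definition weakly_quasi_modular_poly (l : nat) : set (Omega -> {poly C}) :=
  [set P | [/\ calOX P, forall z, (size (P z) <= l.+1)%N
             & forall g, G g -> forall z, pslash k m P (toKoo g) z = P z]].

End QuasiModular.

Lemma det_mx22 (g : 'M[Koo T]_2) : \det g = g 0 0 * g 1 1 - g 0 1 * g 1 0.
Proof.
rewrite (expand_det_row _ 0) !big_ord_recl big_ord0 addr0 /cofactor !det_mx11 !mxE.
rewrite expr0 expr1 mul1r mulN1r mulrN; congr (g _ _ * g _ _ - g _ _ * g _ _);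
  exact/val_inj.
Qed.

Lemma Koo_inB : {morph Koo_in : x y / x - y}.
Proof. by move=> x y; rewrite /Koo_in !rmorphB. Qed.
Lemma Koo_inM : {morph Koo_in : x y / x * y}.
Proof. by move=> x y; rewrite /Koo_in !rmorphM. Qed.
Lemma Koo_in_eq0 x : (Koo_in x == 0) = (x == 0).
Proof. by rewrite /Koo_in !fmorph_eq0. Qed.

Lemma Omega_affine_neq0 (a b : Koo T) (z : Omega) :
  (a != 0) || (b != 0) -> Koo_in a * val z + Koo_in b != 0.
Proof.
case: z => z /= /asboolP zK ab; apply/eqP => e.
have [a0|a0] := eqVneq a 0.
  move: ab e; rewrite a0 eqxx /= => b0.
  by rewrite /Koo_in !rmorph0 mul0r add0r => /eqP; rewrite Koo_in_eq0 (negbTE b0).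
apply: zK; exists (- b / a) => //.
have a0' : Koo_in a != 0 by rewrite Koo_in_eq0.
apply: (mulfI a0'); rewrite -Koo_inM mulrCA mulfV // mulr1.
rewrite -[- b]sub0r Koo_inB {1}/Koo_in !rmorph0 sub0r.
by apply/esym/eqP; rewrite -addr_eq0 e.
Qed.

Lemma autfac_neq0 (g : 'M[Koo T]_2) (z : Omega) :
  g \in unitmx -> autfac g (val z) != 0.
Proof.
move=> gu; apply: Omega_affine_neq0; apply: contraT.
rewrite negb_or !negbK => /andP[/eqP c0 /eqP d0].
by move: gu; rewrite unitmxE det_mx22 c0 d0 !mulr0 subrr unitr0.
Qed.

Lemma mobiusE (g : 'M[Koo T]_2) (z : Omega) :
  g \in unitmx -> val (mobius g z) = mobius_val g (val z).
Proof.
move=> gu; rewrite /mobius val_insubd ifT //; apply/asboolP => -[x _ xE].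
have cz := autfac_neq0 z gu.
have : Koo_in (g 0 0 - x * g 1 0) * val z + Koo_in (g 0 1 - x * g 1 1) == 0.
  rewrite !Koo_inB !Koo_inM mulrBl addrACA -opprD -mulrA -mulrDr.
  by rewrite -/(autfac g (val z)) xE /mobius_val divfK // subrr.
apply/negP/Omega_affine_neq0; apply: contraT.
rewrite negb_or !negbK !subr_eq0 => /andP[/eqP a0 /eqP b0].
by move: gu; rewrite unitmxE det_mx22 a0 b0 mulrAC subrr unitr0.
Qed.

End DrinfeldHalfPlane.

Arguments quasi_modular {R F K v} T G k m l.
Arguments assoc_poly {R F K v} T G k m f.
Arguments weakly_quasi_modular_poly {R F K v} T G k m l.

(* Main.v *)
(** The associated polynomial is read off the values (f | g)(z) at the points
    c / (cz + d), g in G.  For a fixed z these points are infinitely many: G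
    contains the lower unipotent matrices with entry c in some nonzero ideal of
    A, and A is infinite.  Hence a polynomial is determined by its values
    there, and both inclusions follow from the cocycle identities
      j(gh, z) = j(g, hz) j(h, z),
      c/j (g, hz) = (j(h, z)^2 / det h) (c/j (gh, z) - c/j (h, z)).

    That A is infinite is proved by an elementary form of Riemann's inequality.
    Let t have a pole at v and let N = [K : F(t)].  The elements of K that are
    integral at all poles of t other than v form a ring B such that
    dim_F (B / t^-1 B) < N, because v accounts for at least one dimension (weak
    approximation).  On the other hand, the combinations of a basis of K over
    F(t), integral over F[t], with coefficients of degree <= d span a space of
    dimension N (d + 1) over F.  Asking for no pole outside v costs at most
    (N - 1) (d + O(1)) linear conditions, which leaves a space of dimension at
    least d - O(1). *)

Require Import Defs.
From mathcomp Require Import all_boot all_order all_algebra all_field.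
From mathcomp Require Import fraction.
From mathcomp Require Import boolp classical_sets functions cardinality reals.
From mathcomp Require Import zify ring.
Import Order.TTheory GRing.Theory Num.Theory.
Local Open Scope ring_scope.
Local Open Scope classical_set_scope.

Set Implicit Arguments.
Unset Strict Implicit.
Unset Printing Implicit Defensive.

(** * Places and weak approximation *)

Section Places.
Context (F : finFieldType) (K : fieldExtType {fraction {poly F}}).

Definition const_rmorph : {rmorphism F -> K} :=
  in_alg K \o @FracField.tofrac {poly F} \o polyC.

Local Notation phi := const_rmorph.

(* Places send 0 to 0 rather than +oo, hence the separate case. *)
Definition vge (w : K -> int) (m : int) (x : K) := (x == 0) || (m <= w x).

Section OnePlace.
Context (w : K -> int) (hw : is_place w).

Lemma place1 : w 1 = 0.
Proof.
have := placeM hw (oner_neq0 K) (oner_neq0 K).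
by rewrite mulr1 -[LHS]addr0 => /addrI.
Qed.

Lemma placeX x n : x != 0 -> w (x ^+ n) = n%:Z * w x.
Proof.
move=> x0; elim: n => [|n IH]; first by rewrite expr0 mul0r place1.
by rewrite exprS (placeM hw) ?expf_neq0 // IH intS mulrDl mul1r.
Qed.

Lemma placeV x : x != 0 -> w x^-1 = - w x.
Proof.
move=> x0; have := placeM hw x0 (invr_neq0 x0).
by rewrite mulfV // place1; lia.
Qed.

Lemma placeN x : w (- x) = w x.
Proof.
have N1 : (-1 : K) != 0 by rewrite oppr_eq0 oner_neq0.
have wN1 : w (-1) = 0.
  by have := placeM hw N1 N1; rewrite mulrNN mulr1 place1; lia.
have [->|x0] := eqVneq x 0; first by rewrite oppr0.
by rewrite -mulN1r (placeM hw) // wN1 add0r.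
Qed.

(** A nonzero constant equals its own [#|F|]-th power, and [#|F| > 1] then leaves only the value
    0. *)
Lemma place_const c : w (phi c) = 0.
Proof.
have [->|c0] := eqVneq c 0; first by rewrite rmorph0 (place0 hw).
have c0' : phi c != 0 by rewrite fmorph_eq0.
have q1 : (1 < #|F|)%N by exact: finNzRing_gt1.
have := placeX #|F| c0'.
by rewrite -rmorphXn expf_card; nia.
Qed.

Lemma vge0 m : vge w m 0.
Proof. by rewrite /vge eqxx. Qed.

Lemma vge_le m n x : n <= m -> vge w m x -> vge w n x.
Proof. by rewrite /vge => nm /orP[->//|/(le_trans nm) ->]; rewrite orbT. Qed.

Lemma vgeD m x y : vge w m x -> vge w m y -> vge w m (x + y).
Proof.
rewrite /vge; have [->|x0] := eqVneq x 0; first by rewrite add0r.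
have [->|y0] := eqVneq y 0; first by rewrite addr0 (negPf x0).
have [//|s0] := eqVneq (x + y) 0.
by move=> /= mx my; have := placeD hw x0 y0 s0; lia.
Qed.

Lemma vgeN m x : vge w m (- x) = vge w m x.
Proof. by rewrite /vge oppr_eq0 placeN. Qed.

Lemma vgeB m x y : vge w m x -> vge w m y -> vge w m (x - y).
Proof. by move=> mx my; apply: vgeD; rewrite ?vgeN. Qed.

Lemma vgeM m n x y : vge w m x -> vge w n y -> vge w (m + n) (x * y).
Proof.
rewrite /vge mulf_eq0; have [//|x0] := eqVneq x 0.
have [//|y0] := eqVneq y 0.
by move=> /= mx ny; rewrite (placeM hw) //; lia.
Qed.

Lemma vge_const c : vge w 0 (phi c).
Proof. by rewrite /vge place_const lexx orbT. Qed.

Lemma vgeX m n x : vge w m x -> vge w (n%:Z * m) (x ^+ n).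
Proof.
move=> mx; elim: n => [|n IH]; first by rewrite /vge place1 mul0r lexx orbT.
by rewrite exprS intS mulrDl mul1r; exact: vgeM.
Qed.

Lemma vge_sum (I : finType) (P : pred I) m (f : I -> K) :
  (forall i, P i -> vge w m (f i)) -> vge w m (\sum_(i | P i) f i).
Proof. by move=> h; elim/big_ind: _ => //; [exact: vge0|exact: vgeD]. Qed.

Lemma vge_val x : vge w (w x) x.
Proof. by rewrite /vge lexx orbT. Qed.

(** Otherwise [x = (x + y) - y] would have value above [w x]. *)
Lemma placeD_eq x y : x != 0 -> vge w (w x + 1) y ->
  x + y != 0 /\ w (x + y) = w x.
Proof.
move=> x0 wy.
have vx z : vge w (w x + 1) z -> z != x.
  by apply: contraTneq => ->; rewrite /vge (negPf x0); lia.
have s0 : x + y != 0.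
  by rewrite addrC addr_eq0 -eqr_oppLR; apply: vx; rewrite vgeN.
split=> //; apply/eqP; rewrite eq_le; apply/andP; split; last first.
  have : vge w (w x) (x + y) by apply: vgeD; [exact: vge_val | apply: vge_le wy; lia].
  by rewrite /vge (negPf s0).
rewrite leNgt; apply/negP => lt.
have : x + y - y != x.
  by apply: vx; apply: vgeB => //; rewrite /vge; apply/orP; right; lia.
by rewrite addrK eqxx.
Qed.

End OnePlace.

Lemma place_neq_sep (v w : K -> int) : is_place v -> is_place w -> w <> v ->
  exists x, [/\ x != 0, v x < 0 & 0 < w x].
Proof.
(* O_a <= O_b forces b = a: a valuation ring of rank one is a maximal subring,
   and both valuations are normalized. *)
have incl (a b : K -> int) : is_place a -> is_place b ->
    (forall x, x != 0 -> 0 <= a x -> 0 <= b x) -> b = a.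
  move=> ha hb ab.
  have ab0 x : x != 0 -> a x = 0 -> b x = 0.
    move=> x0 ax; have := ab x x0; have := ab _ (invr_neq0 x0).
    by rewrite !placeV // ax; lia.
  (* Every nonzero element is a power of the uniformizer [p] of [a] times an [a]-unit, on which [b]
     vanishes. So [b] is a multiple of [a], and surjectivity of [b] makes the factor 1. *)
  have [p p0 ap] := place_onto ha 1.
  have bE x : x != 0 -> b x = a x * b p.
    move=> x0; case ax : (a x) => [n|n].
    - have := ab0 (x / p ^+ n).
      rewrite mulf_neq0 ?invr_neq0 ?expf_neq0 //.
      rewrite !placeM ?placeV ?placeX ?invr_neq0 ?expf_neq0 // ap => /(_ isT).
      lia.
    - have := ab0 (x * p ^+ n.+1).
      rewrite mulf_neq0 ?expf_neq0 //.
      rewrite !placeM ?placeX ?expf_neq0 // ap => /(_ isT).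
      lia.
  have bp : b p = 1.
    have := ab p p0; rewrite ap => /(_ isT) bp0.
    have [x x0 bx] := place_onto hb 1.
    move: bx; rewrite bE //; have [ax|ax] := leP (a x) 0; nia.
  apply/funext => x; have [->|x0] := eqVneq x 0; first by rewrite !place0.
  by rewrite bE // bp mulr1.
move=> hv hw wv.
have get (a b : K -> int) : is_place a -> is_place b -> b <> a ->
    exists x, [/\ x != 0, 0 <= a x & b x < 0].
  move=> ha hb ne; apply: contrapT => no; apply: ne; apply: incl => // x x0 ax.
  by rewrite leNgt; apply/negP => bx; apply: no; exists x.
have [x [x0 vx wx]] := get v w hv hw wv.
have [y [y0 wy vy]] := get w v hw hv (fun e => wv (esym e)).
exists (y / x); rewrite mulf_neq0 ?invr_neq0 //.
by rewrite !placeM ?placeV ?invr_neq0 //; split=> //; lia.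
Qed.

(** Induction on [ws]: the element [x] for the shorter list is multiplied by some [y] separating [v]
    from the new place [u], after raising [x] to a power that outweighs the poles of [y] on [ws]. A
    pole of [x] at [u] has to be removed first. *)
Lemma weak_approx (v : K -> int) (ws : seq (K -> int)) : is_place v ->
  (forall w, w \in ws -> is_place w /\ w <> v) ->
  exists x, [/\ x != 0, v x < 0 & forall w, w \in ws -> 0 < w x].
Proof.
move=> hv; elim: ws => [|u ws IH] hws.
  by have [x x0 vx] := place_onto hv (-1); exists x; split=> //; rewrite vx.
have [hu uv] := hws u (mem_head _ _).
have [y [y0 vy uy]] := place_neq_sep hv hu uv.
have hws' w : w \in ws -> is_place w /\ w <> v.
  by move=> h; apply: hws; rewrite inE h orbT.
have [x [x0 vx wx]] := IH hws'.
have [B wB] : exists B : nat, forall w, w \in ws -> - w y <= B%:Z.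
  elim: (ws) => [|a s [B hB]]; first by exists 0%N.
  exists (B + `|a y|)%N => w; rewrite inE => /predU1P[->|/hB]; lia.
have wxy w : w \in ws -> 0 < w (x ^+ B.+1 * y).
  move=> h; have [hw _] := hws' w h.
  rewrite (placeM hw) ?expf_neq0 // (placeX hw) //.
  by have := wx w h; have := wB w h; nia.
have [ux|ux] := leP 0 (u x).
  exists (x ^+ B.+1 * y); split; first by rewrite mulf_neq0 ?expf_neq0.
    by rewrite (placeM hv) ?expf_neq0 // (placeX hv) //; nia.
  move=> w; rewrite inE => /predU1P[->|/wxy//].
  by rewrite (placeM hu) ?expf_neq0 // (placeX hu) //; nia.
(* Where x has a pole, x ^ m / (1 + x ^ m) is a unit; where it vanishes, it vanishes. *)
pose X := x ^+ B.+1; have X0 : X != 0 by rewrite expf_neq0.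
have neg w : is_place w -> w x < 0 -> 1 + X != 0 /\ w (1 + X) = w X.
  move=> hw wx0; rewrite addrC; apply: (placeD_eq hw) => //.
  by rewrite /vge place1 // /X placeX //; apply/orP; right; nia.
have pos w : is_place w -> 0 < w x -> w (1 + X) = 0.
  move=> hw wx0; rewrite -(place1 hw); apply: (proj2 (placeD_eq hw _ _)).
    exact: oner_neq0.
  by rewrite /vge place1 // /X placeX //; apply/orP; right; nia.
have [X10 vX] := neg v hv vx; have [_ uX] := neg u hu ux.
have valE w : is_place w -> w (X / (1 + X) * y) = w X - w (1 + X) + w y.
  by move=> hw; rewrite !(placeM hw) ?mulf_neq0 ?invr_neq0 // (placeV hw).
exists (X / (1 + X) * y); split; first by rewrite !mulf_neq0 ?invr_neq0.
  by rewrite valE // vX; lia.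
move=> w; rewrite inE => /predU1P[->|h]; first by rewrite valE // uX; lia.
have [hw _] := hws' w h; rewrite valE // (pos w hw (wx w h)) subr0.
by have := wxy w h; rewrite (placeM hw) ?expf_neq0.
Qed.

End Places.

(** * Dependence over F[t] *)

Section RegularFunctions.
Context (F : finFieldType) (K : fieldExtType {fraction {poly F}}).

Local Notation phi := (const_rmorph K).
Local Notation tofrac := (@FracField.tofrac {poly F}).

Definition peval (t : K) (p : {poly F}) : K := (map_poly phi p).[t].

Lemma pevalB t : {morph peval t : p q / p - q}.
Proof. by move=> p q; rewrite /peval rmorphB hornerD hornerN. Qed.

Lemma peval_linear t c p q : peval t (c *: p + q) = phi c * peval t p + peval t q.
Proof.
by rewrite /peval rmorphD -mul_polyC rmorphM /= map_polyC hornerD hornerM hornerC.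
Qed.

Lemma pevalM t : {morph peval t : p q / p * q}.
Proof. by move=> p q; rewrite /peval rmorphM hornerM. Qed.

Lemma peval0 t : peval t 0 = 0.
Proof. by rewrite /peval rmorph0 horner0. Qed.

Lemma pevalE t n (p : {poly F}) : (size p <= n)%N ->
  peval t p = \sum_(i < n) phi p`_i * t ^+ i.
Proof.
move=> pn; rewrite /peval (horner_coef_wide _ (n := n)) ?size_map_poly //.
by apply: eq_bigr => i _; rewrite coef_map.
Qed.

(** Dependence over the subring F[t] for an arbitrary [t], whereas K is given as a vector space over
    F(T). *)
Definition poly_dependent (t : K) n (x : 'I_n -> K) :=
  exists2 p : 'I_n -> {poly F}, (exists j, p j != 0) &
    \sum_j peval t (p j) * x j = 0.

(** * Degrees of coordinates over F(T) *)

Section Degree.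
Local Notation m := (\dim {:K}).
Local Notation e := (vbasis {:K}).

(** Coordinates of degree below [c] are stored as a matrix over F, so that they form a finite type
    and can be counted. *)
Definition coord_poly (c : nat) (P : 'M[F]_(m, c)) : K :=
  \sum_j tofrac (rVpoly (row j P)) *: e`_j.

Definition coord_le (c : nat) (x : K) := exists P : 'M[F]_(m, c), x = coord_poly P.

Lemma coord_leP c x : coord_le c x <->
  exists2 p : 'I_m -> {poly F}, (forall j, (size (p j) <= c)%N) &
    x = \sum_j tofrac (p j) *: e`_j.
Proof.
split=> [[P ->]|[p pc ->]].
  by exists (fun j => rVpoly (row j P)) => // j; apply: size_poly.
exists (\matrix_(j, i) (p j)`_i); apply: eq_bigr => j _; congr (tofrac _ *: _).
apply/polyP => i; rewrite coef_rVpoly; case: insubP => [k _ ki|].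
  by rewrite !mxE ki.
by rewrite -leqNgt => ci; rewrite nth_default // (leq_trans (pc j)).
Qed.

Lemma coord_le_mono c d x : (c <= d)%N -> coord_le c x -> coord_le d x.
Proof.
move=> cd /coord_leP[p pc ->]; apply/coord_leP; exists p => // j.
exact: leq_trans cd.
Qed.

Lemma coord_le0 c : coord_le c 0.
Proof.
apply/coord_leP; exists (fun=> 0) => [j|]; first by rewrite size_poly0.
by rewrite big1 // => j _; rewrite rmorph0 scale0r.
Qed.

Lemma coord_leD c x y : coord_le c x -> coord_le c y -> coord_le c (x + y).
Proof.
move=> /coord_leP[p pc ->] /coord_leP[q qc ->]; apply/coord_leP.
exists (fun j => p j + q j) => [j|].
  by rewrite (leq_trans (size_polyD _ _)) // geq_max pc qc.
by rewrite -big_split; apply: eq_bigr => j _; rewrite rmorphD scalerDl.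
Qed.

Lemma coord_le_sum (I : finType) c (f : I -> K) :
  (forall i, coord_le c (f i)) -> coord_le c (\sum_i f i).
Proof. by move=> h; elim/big_ind: _ => //; [exact: coord_le0|exact: coord_leD]. Qed.

Lemma coord_leZ c d (q : {poly F}) x : (size q <= d.+1)%N ->
  coord_le c x -> coord_le (c + d) (tofrac q *: x).
Proof.
move=> qd /coord_leP[p pc ->]; apply/coord_leP.
exists (fun j => q * p j) => [j|].
  by have := size_polyMleq q (p j); have := pc j; lia.
by rewrite scaler_sumr; apply: eq_bigr => j _; rewrite rmorphM scalerA.
Qed.

Lemma frac_denom (x : {fraction {poly F}}) :
  exists2 q : {poly F}, q != 0 & exists p, tofrac q * x = tofrac p.
Proof.
exists \d_(repr x); first exact: denom_ratioP.
exists \n_(repr x); rewrite -[x in LHS]reprK !piE.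
apply/eqmodP; rewrite /= FracField.equivfE /FracField.mulf.
rewrite !numden_Ratio ?mulf_neq0 ?oner_neq0 ?denom_ratioP //.
by rewrite !mulr1 !mul1r reprK.
Qed.

Lemma coord_le_family n (x : 'I_n -> K) : exists2 Q : {poly F}, Q != 0 &
  exists c, forall j, coord_le c (tofrac Q *: x j).
Proof.
have one (y : K) : exists2 Q : {poly F}, Q != 0 & exists c, coord_le c (tofrac Q *: y).
  have [q qP] := choice (fun j => let: ex_intro2 a b h := frac_denom (coord e j y) in
    ex_intro (fun q => q != 0 /\ exists p, tofrac q * coord e j y = tofrac p) a (conj b h)).
  have [p pP] := choice (fun j => (qP j).2).
  exists (\prod_j q j); first by apply/prodf_neq0 => j _; case: (qP j).
  pose r j := p j * \prod_(i | i != j) q i.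
  exists (\max_j size (r j)); apply/coord_leP; exists r => [j|].
    exact: leq_bigmax.
  rewrite {1}(coord_vbasis (memvf y)) scaler_sumr; apply: eq_bigr => j _.
  rewrite scalerA; congr (_ *: _).
  by rewrite (bigD1 j) //= rmorphM mulrAC pP -rmorphM.
have [q qP] := choice (fun j => let: ex_intro2 a b h := one (x j) in
  ex_intro (fun q => q != 0 /\ exists c, coord_le c (tofrac q *: x j)) a (conj b h)).
have [c cP] := choice (fun j => (qP j).2).
exists (\prod_j q j); first by apply/prodf_neq0 => j _; case: (qP j).
pose r j := \prod_(i | i != j) q i.
exists (\max_j (c j + size (r j))) => j.
apply: (@coord_le_mono (c j + size (r j))).
  exact: (leq_bigmax (F := fun j => (c j + size (r j))%N)).
rewrite (bigD1 j) //= mulrC rmorphM -scalerA.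
exact: coord_leZ.
Qed.

(** Multiplication by [t] is F(T)-linear, so [Q] is a common denominator of its matrix. The bound on
    [size Q] makes surplus factors [Q] obey the same degree estimate. *)
Lemma coord_le_mul (t : K) : exists2 Q : {poly F}, Q != 0 & exists d, 
  (size Q <= d.+1)%N /\ forall c x, coord_le c x -> coord_le (c + d) (tofrac Q *: (t * x)).
Proof.
have [Q Q0 [c0 cP]] := coord_le_family (fun j : 'I_m => t * e`_j).
exists Q => //; exists (c0 + size Q)%N; split; first by lia.
move=> c x /coord_leP[p pc ->].
rewrite mulr_sumr scaler_sumr; apply: coord_le_sum => j.
rewrite -scalerAr scalerA mulrC -scalerA.
apply: (@coord_le_mono (c0 + c)); first by lia.
by apply: coord_leZ => //; have := pc j; lia.
Qed.

(* F is finite, so a pigeonhole count replaces a dimension count over F. *)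
Lemma poly_dependent_bounded (t : K) :
  exists n, forall x : 'I_n -> K, poly_dependent t x.
Proof.
have [Q Q0 [d [Qd Qt]]] := coord_le_mul t.
exists (m * d).+1 => x.
have [q q0 [c xc]] := coord_le_family x.
(* With this [N], the [(m * d + 1) * (N + 1)] entries of the source outnumber the [m * (c + d * N)]
   entries of the target. *)
pose N := (m * c)%N.
pose f (B : 'M[F]_((m * d).+1, N.+1)) : K :=
  tofrac (Q ^+ N) *: \sum_j peval t (rVpoly (row j B)) * (tofrac q *: x j).
(* Each factor [t] is paid for by a factor [Q], at a cost of [d] in degree; [powQ] takes care of the
   factors of [Q ^+ N] left over in low powers of [t]. *)
have pow i y a : coord_le a y -> coord_le (a + d * i) (tofrac (Q ^+ i) *: (t ^+ i * y)).
  move=> ay; elim: i => [|i IH].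
    by rewrite !expr0 rmorph1 scale1r mul1r; apply: coord_le_mono ay; lia.
  rewrite !exprS rmorphM -mulrA -scalerA.
  have -> : (a + d * i.+1 = a + d * i + d)%N by lia.
  by rewrite [tofrac (Q ^+ i) *: _]scalerAr; apply: Qt.
have powQ i y a : coord_le a y -> coord_le (a + d * i) (tofrac (Q ^+ i) *: y).
  move=> ay; elim: i => [|i IH].
    by rewrite !expr0 rmorph1 scale1r; apply: coord_le_mono ay; lia.
  rewrite !exprS rmorphM -scalerA.
  have -> : (a + d * i.+1 = a + d * i + d)%N by lia.
  exact: coord_leZ.
have fc B : coord_le (c + d * N) (f B).
  rewrite /f scaler_sumr; apply: coord_le_sum => j.
  rewrite (pevalE t (size_poly _ _)) mulr_suml scaler_sumr; apply: coord_le_sum => i.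
  rewrite -mulrA [phi _]/(_%:A) -scalerAl mul1r scalerA mulrC -scalerA.
  have iN : (i <= N)%N by rewrite -ltnS.
  rewrite -(addn0 (_ + _)%N); apply: coord_leZ.
    by rewrite size_polyC; case: (_ == _).
  have -> : Q ^+ N = Q ^+ (N - i) * Q ^+ i by rewrite -exprD subnK.
  have -> : (c + d * N = c + d * i + d * (N - i))%N by rewrite -addnA -mulnDr subnKC.
  by rewrite rmorphM -scalerA; apply: powQ; apply: pow.
have [g gP] := choice fc.
have ninj : ~ injective g.
  move=> /leq_card; rewrite !card_mx leqNgt ltn_exp2l ?finNzRing_gt1 //.
  by apply/negP/negPn; rewrite /N; nia.
have [B [B' [gB BB']]] : exists B B', g B = g B' /\ B <> B'.
  apply: contrapT => no; apply: ninj => B B' gB; apply: contrapT => ne.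
  by apply: no; exists B, B'.
exists (fun j => rVpoly (row j (B - B'))).
  apply: contrapT => no; apply: BB'; apply/eqP; rewrite -subr_eq0; apply/eqP.
  apply/row_matrixP => j; rewrite row0; apply: (can_inj rVpolyK).
  by apply: contrapT => /eqP h; apply: no; exists j; rewrite linear0 in h.
have /eqP : f B - f B' = 0 by rewrite !gP gB subrr.
rewrite /f -scalerBr -sumrB scaler_eq0 tofrac_eq0 expf_eq0 (negPf Q0) andbF /=.
under eq_bigr do rewrite -mulrBl -pevalB -linearB -linearB -scalerAr.
by rewrite -scaler_sumr scaler_eq0 tofrac_eq0 (negPf q0) => /eqP.
Qed.

End Degree.
End RegularFunctions.

(** * Infinitely many functions regular outside a place *)

Section InfinitelyManyRegular.
Context (F : finFieldType) (K : fieldExtType {fraction {poly F}}).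

Local Notation phi := (const_rmorph K).

Lemma vge_peval (w : K -> int) t p : is_place w -> vge w 0 t -> vge w 0 (peval t p).
Proof.
move=> hw wt; rewrite (pevalE t (leqnn _)); apply: vge_sum => // i _.
rewrite -[0]addr0; apply: vgeM => //; first exact: vge_const.
by have := vgeX hw i wt; rewrite mulr0.
Qed.

(** The leading term strictly dominates; in particular an element with a pole is transcendental over
    F. *)
Lemma place_peval (w : K -> int) t p : is_place w -> w t < 0 -> p != 0 ->
  peval t p != 0 /\ w (peval t p) = (size p).-1%:Z * w t.
Proof.
move=> hw wt p0; have t0 : t != 0 by apply: contraTneq wt => ->; rewrite (place0 hw).
have [d pd] : exists d, size p = d.+1.
  by exists (size p).-1; rewrite prednK // size_poly_gt0.
have l0 : phi p`_d != 0.
  by rewrite fmorph_eq0; move: p0; rewrite -lead_coef_eq0 lead_coefE pd.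
have wl : w (phi p`_d * t ^+ d) = d%:Z * w t.
  by rewrite (placeM hw) ?expf_neq0 // place_const // add0r placeX.
rewrite (pevalE t (leqnn _)) pd big_ord_recr /= addrC -wl.
apply: placeD_eq => //; first by rewrite mulf_neq0 ?expf_neq0.
rewrite wl; apply: vge_sum => // i _; rewrite -[_ + 1]add0r.
apply: vgeM => //; first exact: vge_const.
rewrite /vge placeX //; apply/orP; right.
by have := ltn_ord i; move: (i : nat) => a; nia.
Qed.

(** Dividing the relation by [t ^+ N], with [N] the largest degree, isolates the coefficients of
    degree [N]. The lower terms fall into [t^-1] times F[1/t], whose elements are integral at the
    poles of [t]. *)
Lemma poly_dependent_reduction (t : K) n (x : 'I_n -> K) : t != 0 ->
  poly_dependent t x ->
  exists (c : 'I_n -> F) (r : 'I_n -> K), [/\ exists j, c j != 0,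
    forall w, is_place w -> w t < 0 -> forall j, vge w 0 (r j) &
    \sum_j phi (c j) * x j = t^-1 * \sum_j r j * x j].
Proof.
move=> t0 [p [j0 pj0] px].
have n0 : (0 < #|'I_n|)%N by apply/card_gt0P; exists j0.
have [j1 j1P] := @bigop.eq_bigmax _ (fun j => size (p j)) n0.
have sz j : (size (p j) <= size (p j1))%N.
  by rewrite -j1P; exact: (leq_bigmax (F := fun j => size (p j))).
have [N pN] : exists N, size (p j1) = N.+1.
  exists (size (p j1)).-1; rewrite prednK // (leq_trans _ (sz j0)) //.
  by rewrite size_poly_gt0.
pose r j := - \sum_(i < N) phi (p j)`_i * t^-1 ^+ (N - i.+1).
exists (fun j => (p j)`_N), r; split.
- exists j1; have : lead_coef (p j1) != 0 by rewrite lead_coef_eq0 -size_poly_eq0 pN.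
  by rewrite lead_coefE pN.
- move=> w hw wt j; rewrite vgeN //; apply: vge_sum => // i _; rewrite -[0]addr0.
  apply: vgeM => //; first exact: vge_const.
  have wt' : vge w 0 t^-1 by rewrite /vge placeV //; apply/orP; right; lia.
  by have := vgeX hw (N - i.+1) wt'; rewrite mulr0.
have tN : t ^+ N != 0 by rewrite expf_neq0.
apply: (mulfI tN); rewrite !mulr_sumr; apply/eqP; rewrite -subr_eq0 -sumrB.
rewrite -[X in _ == X]px; apply/eqP/eq_bigr => j _.
have pjN : (size (p j) <= N.+1)%N by rewrite -pN.
rewrite (pevalE t pjN) big_ord_recr /= mulrDl addrC.
rewrite mulrA (mulrC (t ^+ N)); congr (_ + _); last by rewrite mulrCA mulrA.
rewrite /r mulNr !mulrN opprK !mulrA; congr (_ * _).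
rewrite mulr_sumr; apply: eq_bigr => i _.
rewrite [LHS]mulrCA; congr (_ * _).
have iN := ltn_ord i.
rewrite mulrAC -exprS -subSn // subSS exprVn mulrC.
have -> : t ^+ N = t ^+ i * t ^+ (N - i) by rewrite -exprD subnKC // ltnW.
by rewrite mulfK ?expf_neq0.
Qed.

(** The number [n.+1] is the degree of K over F(t), one less than the least size at which all
    families are dependent. *)
Lemma max_independent (w : K -> int) t : is_place w -> w t < 0 ->
  exists n, (exists b : 'I_n.+1 -> K, ~ poly_dependent t b) /\
    forall x : 'I_n.+2 -> K, poly_dependent t x.
Proof.
move=> hw wt; have [n0 n0P] := poly_dependent_bounded t.
have ex : exists n, `[< forall x : 'I_n -> K, poly_dependent t x >].
  by exists n0; apply/asboolP.
(* Size 0 is excluded because a dependence needs an index, size 1 because [t] is transcendental. *)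
case: (ex_minnP ex) => -[|[|n]] /asboolP dep nmin.
- by have [p [[]]] := dep (fun=> 0).
- have [p [j pj]] := dep (fun=> 1); rewrite (ord1 j) in pj.
  rewrite big_ord1 mulr1 => /eqP.
  by rewrite (negPf (proj1 (place_peval hw wt pj))).
exists n; split=> //; apply: contrapT => no.
have /nmin : `[< forall x : 'I_n.+1 -> K, poly_dependent t x >].
  by apply/asboolP => x; apply: contrapT => h; apply: no; exists x.
by rewrite ltnn.
Qed.

(** Given [n] distinct poles, let [x j] have a pole at the [j]-th and zeros at the others. In a
    relation modulo [t^-1] with [c i] nonzero, [phi (c i) * x i] has strictly smallest value at the
    [i]-th pole, which is impossible. *)
Lemma finite_poles t n : (forall x : 'I_n -> K, poly_dependent t x) ->
  exists ws : seq (K -> int), forall w, is_place w -> w t < 0 -> w \in ws.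
Proof.
move=> dep; apply: contrapT => no.
have many k : exists ws : seq (K -> int), [/\ size ws = k, uniq ws &
    forall w, w \in ws -> is_place w /\ w t < 0].
  elim: k => [|k [ws [sw uw hws]]]; first by exists [::].
  apply: contrapT => no'; apply: no; exists ws => w hw wt.
  apply: contraT => nw; exfalso; apply: no'; exists (w :: ws).
  rewrite /= sw nw uw; split=> // u; rewrite inE => /predU1P[->//|]; exact: hws.
have [ws [sw uw hws]] := many n.
pose W (j : 'I_n) := nth (fun=> 0) ws j.
have WP j : W j \in ws by rewrite mem_nth // sw.
have hW j : is_place (W j) by case: (hws _ (WP j)).
have Wt j : W j t < 0 by case: (hws _ (WP j)).
have xP j : exists x, [/\ x != 0, W j x < 0 & forall i, i != j -> 0 < W i x].
  have [] := @weak_approx _ _ (W j) [seq w <- ws | w != W j] (hW j).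
    by move=> w; rewrite mem_filter => /andP[/eqP ne /hws[]].
  move=> x [x0 xj xi]; exists x; split=> // i ij; apply: xi.
  by rewrite mem_filter WP andbT /W nth_uniq ?sw.
have [x {}xP] := choice xP.
have [j _] : exists j : 'I_n, True by have [p [j]] := dep (fun=> 0); exists j.
have t0 : t != 0 by apply: contraTneq (Wt j) => ->; rewrite (place0 (hW j)).
have {j} [c [r [[i ci] rP]]] := poly_dependent_reduction t0 (dep x).
have [xi0 xii _] := xP i.
have xij j : j != i -> vge (W i) (W i (x i) + 1) (x j).
  move=> ji; have [_ _ /(_ i)] := xP j; rewrite eq_sym => /(_ ji) h.
  by rewrite /vge; apply/orP; right; lia.
rewrite (bigD1 i) //= => /eqP; rewrite eq_sym -subr_eq => /eqP E.
have : vge (W i) (W i (x i) + 1) (phi (c i) * x i).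
  rewrite -E; apply: vgeB => //; last first.
    apply: vge_sum => // j ji; rewrite -[_ + 1]add0r; apply: vgeM => //.
      exact: vge_const.
    exact: xij.
  rewrite addrC; apply: vgeM => //.
    by rewrite /vge placeV //; apply/orP; right; have := Wt i; lia.
  apply: vge_sum => // j _; rewrite -[W i _]add0r; apply: vgeM => //; first exact: rP.
  have [->|ji] := eqVneq j i; first exact: vge_val.
  by apply: vge_le (xij j ji); lia.
have ci' : phi (c i) != 0 by rewrite fmorph_eq0.
rewrite /vge mulf_eq0 (negPf ci') (negPf xi0) /=.
by rewrite (placeM (hW i)) // place_const //; lia.
Qed.

(** * Integrality at the poles of t other than v *)

Section AwayFromV.
Context (v : K -> int) (hv : is_place v) (t : K) (vt : v t < 0).
Context (n : nat) (dep : forall x : 'I_n.+2 -> K, poly_dependent t x).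

Definition away_int (x : K) :=
  forall w, is_place w -> w <> v -> w t < 0 -> vge w 0 x.

Let t0 : t != 0.
Proof. by apply: contraTneq vt => ->; rewrite (place0 hv). Qed.

Lemma away_int0 : away_int 0. Proof. by move=> *; apply: vge0. Qed.

Lemma away_intD x y : away_int x -> away_int y -> away_int (x + y).
Proof. by move=> hx hy w hw wv wt; apply: vgeD => //; [exact: hx|exact: hy]. Qed.

Lemma away_intN x : away_int x -> away_int (- x).
Proof. by move=> hx w hw wv wt; rewrite vgeN //; exact: hx. Qed.

Lemma away_intM x y : away_int x -> away_int y -> away_int (x * y).
Proof.
by move=> hx hy w hw wv wt; rewrite -[0]addr0; apply: vgeM => //; [exact: hx|exact: hy].
Qed.

Lemma away_int_const c : away_int (phi c).
Proof. by move=> w hw _ _; exact: vge_const. Qed.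

Lemma away_int_sum (I : finType) (f : I -> K) :
  (forall i, away_int (f i)) -> away_int (\sum_i f i).
Proof. by move=> h w hw wv wt; apply: vge_sum => // i _; exact: h. Qed.

(** For [X] a high power of an element with a pole at [v] and zeros at the other poles of [t],
    [(1 + X)^-1] is small at [v] and congruent to 1 modulo [t^-1] at those poles. *)
Lemma approx_zero_one (M : nat) : exists y, [/\ y != 0, vge v M%:Z y,
  away_int y & away_int (t * (1 - y))].
Proof.
have [ws wsP] := finite_poles dep.
have [] := @weak_approx _ _ v [seq w <- ws | `[< is_place w /\ w <> v >]] hv.
  by move=> w; rewrite mem_filter => /andP[/asboolP].
move=> x [x0 vx wx].
have {}wx w : is_place w -> w <> v -> w t < 0 -> 0 < w x.
  move=> hw wv wt; apply: wx; rewrite mem_filter wsP // andbT.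
  by apply/asboolP.
have [B wB] : exists B : nat, forall w, is_place w -> w t < 0 -> - w t <= B%:Z.
  suff [B wB] : exists B : nat, forall w, w \in ws -> - w t <= B%:Z.
    by exists B => w hw wt; apply/wB/wsP.
  elim: (ws) => [|a s [B hB]]; first by exists 0%N.
  exists (B + `|a t|)%N => w; rewrite inE => /predU1P[->|/hB]; lia.
pose X := x ^+ (M + B).+1; have X0 : X != 0 by rewrite expf_neq0.
have [X10 vX] : 1 + X != 0 /\ v (1 + X) = v X.
  rewrite addrC; apply: (placeD_eq hv) => //.
  by rewrite /vge place1 // /X placeX //; apply/orP; right; nia.
have wX w : is_place w -> w <> v -> w t < 0 -> w (1 + X) = 0.
  move=> hw wv wt; rewrite -(place1 hw); apply: (proj2 (placeD_eq hw _ _)).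
    exact: oner_neq0.
  rewrite /vge place1 // /X placeX //; apply/orP; right.
  by have := wx w hw wv wt; nia.
exists (1 + X)^-1; split; first by rewrite invr_neq0.
- by rewrite /vge placeV // vX /X placeX //; apply/orP; right; nia.
- by move=> w hw wv wt; rewrite /vge placeV // wX // oppr0 lexx orbT.
have -> : 1 - (1 + X)^-1 = X / (1 + X) 
  by apply: (mulIf X10); rewrite divfK // mulrBl mul1r mulVf // addrAC subrr add0r.
move=> w hw wv wt; rewrite /vge !(placeM hw) ?mulf_neq0 ?invr_neq0 // placeV // wX //.
rewrite /X placeX //; apply/orP; right.
by have := wx w hw wv wt; have := wB w hw wt; nia.
Qed.

(* The fundamental inequality at work: the place v uses up at least one of the
   at most n + 1 dimensions of (integral elements) / t^-1. *)
Lemma away_int_dependent (x : 'I_n.+1 -> K) : (forall j, away_int (x j)) ->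
  exists2 c : 'I_n.+1 -> F, (exists j, c j != 0) &
    away_int (t * \sum_j phi (c j) * x j).
Proof.
move=> hx.
have [M xM] : exists M : nat, forall j, vge v (1 - M%:Z) (x j).
  exists (\max_j `|v (x j)|).+1 => j.
  have := leq_bigmax (F := fun j => `|v (x j)|%N) j.
  by rewrite /vge; move: (bigop _ _ _) => B h; apply/orP; right; lia.
have [y [y0 yM yint y1]] := approx_zero_one M.+1.
have [z0 vz] : 1 - y != 0 /\ v (1 - y) = v 1.
  apply: placeD_eq => //; first exact: oner_neq0.
  by rewrite vgeN // place1 //; apply: vge_le yM; lia.
(* The extra member [1 - y] stands for the dimension used up by [v]: it is a unit there, so no
   relation modulo [t^-1] can involve it alone. *)
pose X (j : 'I_n.+2) := if unlift ord0 j is Some i then y * x i else 1 - y.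
have [c [r [cN0 rP]]] := poly_dependent_reduction t0 (dep X).
rewrite [LHS]big_ord_recl [X in _ = _ * X]big_ord_recl /X unlift_none.
under eq_bigr do rewrite liftK.
under [in RHS]eq_bigr do rewrite liftK.
move=> E; exists (fun j => c (lift ord0 j)).
  apply: contrapT => no.
  have c0 j : c (lift ord0 j) = 0.
    by apply: contrapT => /eqP h; apply: no; exists j.
  have c00 : c ord0 != 0.
    have [j] := cN0; case: (unliftP ord0 j) => [i|] -> //.
    by rewrite c0 eqxx.
  move: E; rewrite big1 ?addr0 => [E|i _]; last by rewrite c0 rmorph0 mul0r.
  have c00' : phi (c ord0) != 0 by rewrite fmorph_eq0.
  have : vge v 1 (phi (c ord0) * (1 - y)).
    rewrite E -[1]addr0; apply: vgeM => //.
      by rewrite /vge placeV //; apply/orP; right; lia.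
    apply: vgeD => //.
      rewrite -[0]addr0; apply: vgeM => //; first exact: rP.
      by rewrite /vge vz place1 // lexx orbT.
    apply: vge_sum => // j _; rewrite -[0]add0r; apply: vgeM => //; first exact: rP.
    by apply: vge_le (vgeM hv yM (xM j)); lia.
  rewrite /vge mulf_eq0 (negPf c00') (negPf z0) /=.
  by rewrite (placeM hv) // place_const // vz place1.
have rint j : away_int (r j) by move=> w hw _ wt; exact: rP.
(* This rewrites the relation [E] so that multiplication by [t] only meets [t * (1 - y)] and
   [t * t^-1], both integral away from [v]. *)
have -> : \sum_j phi (c (lift ord0 j)) * x j =
    (1 - y) * (\sum_j phi (c (lift ord0 j)) * x j - phi (c ord0)) +
    t^-1 * (r ord0 * (1 - y) + \sum_i r (lift ord0 i) * (y * x i)).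
  have yE : \sum_i phi (c (lift ord0 i)) * (y * x i) =
      y * \sum_i phi (c (lift ord0 i)) * x i.
    by rewrite mulr_sumr; apply: eq_bigr => i _; rewrite mulrCA.
  by rewrite -E yE; ring.
rewrite mulrDr mulrA mulVKf //; apply: away_intD.
  apply: away_intM => //; apply: away_intD.
    by apply: away_int_sum => j; apply: away_intM => //; exact: away_int_const.
  by apply: away_intN; exact: away_int_const.
apply: away_intD.
  apply: away_intM => //; apply: away_intD; last exact: away_intN.
  by rewrite -(rmorph1 phi); exact: away_int_const.
by apply: away_int_sum => j; apply: away_intM => //; exact: away_intM.
Qed.

End AwayFromV.
End InfinitelyManyRegular.

(** As [Z] is only a predicate, a subspace inside it is grown line by line: a combination of [n.+1]
    basis vectors of [W] gives a nonzero vector in [Z], and the search resumes in a complement of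
    its line. This expresses that [Z] has codimension at most [n] in [W]. *)
Lemma subspace_codim_le (L : fieldType) (U : vectType L) (Z : U -> Prop) n :
  Z 0 -> (forall a u w, Z u -> Z w -> Z (a *: u + w)) ->
  forall d (W : {vspace U}),
    (forall x : 'I_n.+1 -> U, (forall j, x j \in W) ->
      exists2 c : 'I_n.+1 -> L, (exists j, c j != 0) & Z (\sum_j c j *: x j)) ->
    (n + d <= \dim W)%N ->
  exists W' : {vspace U}, [/\ (W' <= W)%VS, \dim W' = d & forall u, u \in W' -> Z u].
Proof.
move=> Z0 Zlin; elim=> [|d IH] W depW dW.
  exists 0%VS; rewrite sub0v dimv0; split=> // u.
  by rewrite memv0 => /eqP ->.
pose X := vbasis W.
have nW (j : 'I_n.+1) : (j < \dim W)%N by have := ltn_ord j; lia.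
have xW (j : 'I_n.+1) : X`_j \in W by apply: vbasis_mem; rewrite mem_nth // size_tuple.
have [c [j cj] Zu] := depW (fun j : 'I_n.+1 => X`_j) xW.
set u := \sum_j _ in Zu.
have uW : u \in W by apply: memv_suml => i _; rewrite memvZ.
have u0 : u != 0.
  apply: contra cj => /eqP u0.
  have /freeP := basis_free (vbasisP W).
  move=> /(_ (fun i => if insub (i : nat) is Some k then c k else 0)).
  move=> /(_ _ (Ordinal (nW j))) /=; rewrite valK => -> //.
  rewrite -[RHS]u0 /u.
  rewrite [LHS](bigID (fun i : 'I__ => (i < n.+1)%N)) /= [X in _ + X]big1 ?addr0.
    have nW' : (n.+1 <= \dim W)%N by lia.
        rewrite (big_ord_narrow nW'); apply: eq_bigr => i _ /=.
    by rewrite valK.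
  by move=> i ni; rewrite insubF ?scale0r //; apply/negbTE.
pose W2 := (W :\: <[u]>)%VS.
have W2W : (W2 <= W)%VS by apply: diffvSl.
have dW2 : (n + d <= \dim W2)%N.
  have := dimv_cap_compl W <[u]>; rewrite -/W2.
  have := dimvS (capvSr W <[u]>); rewrite dim_vline; case: (u != 0) => /=; lia.
have [|W' [W'W dW' ZW']] := IH W2 _ dW2.
  by move=> x xW2; apply: depW => i; apply: (subvP W2W).
exists (<[u]> + W')%VS; split.
- by rewrite subv_add (subv_trans W'W W2W) andbT -memvE.
- rewrite dimv_disjoint_sum ?dim_vline ?u0 ?dW' //.
  apply/eqP; rewrite -subv0 -(capv_diff W <[u]>) capvC.
  exact: capvS.
move=> z /memv_addP[_ /vlineP[a ->] [w wW' ->]].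
by apply: Zlin => //; apply: ZW'.
Qed.

(** * Counting linear conditions, as in Riemann's inequality *)

Section RegularInfinite.
Context (F : finFieldType) (K : fieldExtType {fraction {poly F}}).
Local Notation phi := (const_rmorph K).

Section Subspace.
Context (v : K -> int) (hv : is_place v) (t : K) (vt : v t < 0).
Context (n : nat) (dep : forall x : 'I_n.+2 -> K, poly_dependent t x).
Context (U : vectType F) (f : U -> K).
Hypothesis flin : forall a u w, f (a *: u + w) = phi a * f u + f w.
Hypothesis fint : forall u, away_int v t (f u).

Let f0 : f 0 = 0.
Proof.
by have := flin 1 0 0; rewrite scaler0 addr0 rmorph1 mul1r -[LHS]addr0 => /addrI.
Qed.

Let fsum k (c : 'I_k -> F) x : f (\sum_j c j *: x j) = \sum_j phi (c j) * f (x j).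
Proof.
elim: k c x => [|k IH] c x; first by rewrite !big_ord0.
by rewrite !big_ord_recl flin IH.
Qed.

(** By [away_int_dependent], each further factor [t] costs at most [n] linear conditions. *)
Lemma away_int_subspace M d : (n * M + d <= \dim {:U})%N ->
  exists2 W : {vspace U}, (d <= \dim W)%N &
    forall u, u \in W -> away_int v t (t ^+ M * f u).
Proof.
elim: M d => [|M IH] d dU.
  exists fullv => [|u _]; first by rewrite muln0 in dU.
  by rewrite expr0 mul1r.
have [|W dW WM] := IH (n + d)%N; first by lia.
have [] := @subspace_codim_le _ _ (fun u => away_int v t (t ^+ M.+1 * f u)) n _ _ d W _ dW.
- by rewrite f0 mulr0; exact: away_int0.
- move=> a u w hu hw; rewrite flin mulrDr mulrCA; apply: away_intD => //.
  by apply: away_intM => //; exact: away_int_const.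
- move=> x xW.
  have [c c0 hc] := away_int_dependent hv vt dep (fun j => WM _ (xW j)).
  exists c => //; rewrite fsum exprS -mulrA.
  by move: hc; under eq_bigr do rewrite mulrCA; rewrite -mulr_sumr.
by move=> W' [_ dW' hW']; exists W'; rewrite ?dW'.
Qed.

End Subspace.

(** Here [g] is the leading coefficient of an equation for [b] over F[t], which makes
    [peval t g * b] integral over F[t]. Comparing terms also bounds its order at the poles of [t],
    uniformly in [w]. *)
Lemma integral_multiple (v : K -> int) (t : K) n : is_place v -> v t < 0 ->
  (forall x : 'I_n -> K, poly_dependent t x) -> forall b : K,
  exists2 g : {poly F}, g != 0 & exists C : nat, forall w, is_place w ->
    (vge w 0 t -> vge w 0 (peval t g * b)) /\
    (w t < 0 -> vge w (C%:Z * w t) (peval t g * b)).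
Proof.
move=> hv vt dep b.
have [p [j0 pj0] px] := dep (fun j => b ^+ j).
have [d pd dmax] := @arg_maxnP _ j0 (fun j => p j != 0) (fun j => j : nat) pj0.
have [g0 _] := place_peval hv vt pd.
exists (p d) => //; exists (\max_j size (p j)) => w hw.
(* Otherwise the term of index d would dominate in the relation px. *)
have key m : m <= 0 -> (forall i, vge w m (peval t (p i))) -> vge w m (peval t (p d) * b).
  move=> m0 hm; have [->|b0] := eqVneq b 0; first by rewrite mulr0 vge0.
  apply: contraT; rewrite /vge mulf_eq0 (negPf g0) (negPf b0) /=.
  rewrite (placeM hw) // -ltNge => lt.
  have gm : m <= w (peval t (p d)) by have := hm d; rewrite /vge (negPf g0).
  have Td : w (peval t (p d) * b ^+ d) = w (peval t (p d)) + d%:Z * w b.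
    by rewrite (placeM hw) ?expf_neq0 // placeX.
  have [] := @placeD_eq _ _ w hw (peval t (p d) * b ^+ d)
     (\sum_(i | i != d) peval t (p i) * b ^+ i).
  - by rewrite mulf_neq0 ?expf_neq0.
  - apply: vge_sum => // i id; have [->|pi] := eqVneq (p i) 0.
      by rewrite peval0 mul0r vge0.
    have ltid : (i < d)%N by rewrite ltn_neqAle id; exact: dmax.
    have [pi0 _] := place_peval hv vt pi.
    apply/orP; right; rewrite Td (placeM hw) ?expf_neq0 // placeX //.
    have := hm i; rewrite /vge (negPf pi0) /=.
    by move: (i : nat) (d : nat) ltid => i' d'; nia.
  by move: px; rewrite (bigD1 d) //= => ->; rewrite eqxx.
split=> [wt|wt]; first by apply: key => // i; exact: vge_peval.
apply: key => [|i]; first by nia.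
have [->|pi] := eqVneq (p i) 0; first by rewrite peval0 vge0.
have [pi0 wi] := place_peval hw wt pi; rewrite /vge wi; apply/orP; right.
have := leq_bigmax (F := fun j => size (p j)) i.
by move: (bigop _ _ _) (size _) => A B; nia.
Qed.

Lemma regular_outside_infinite (v : K -> int) : is_place v -> forall N,
  exists s : seq K, [/\ uniq s, (N <= size s)%N &
    forall x, x \in s -> regular_outside v x].
Proof.
move=> hv N; have [t t0 vt1] := place_onto hv (-1).
have vt : v t < 0 by rewrite vt1.
have [n [[b bfree] dep]] := max_independent hv vt.
have H j : exists g, g != 0 /\ exists C : nat, forall w, is_place w ->
    (vge w 0 t -> vge w 0 (peval t g * b j)) /\
    (w t < 0 -> vge w (C%:Z * w t) (peval t g * b j)).
  by have [g g0 h] := integral_multiple hv vt dep (b j); exists g.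
have [g gP] := choice H.
have [C CP] := choice (fun j => (gP j).2).
pose b' j := peval t (g j) * b j.
pose D := \max_j C j.
(* [M] makes [f] below integral at the poles of [t], and [N'] gives [n * M + N <= n.+1 * N'.+1], so
   that dimension [N] survives all conditions. *)
pose N' := (N + n * D)%N; pose M := (N' + D)%N.
pose a (A : 'M[F]_(n.+1, N'.+1)) := \sum_j peval t (rVpoly (row j A)) * b' j.
pose f A := t^-1 ^+ M * a A.
have alin c A B : a (c *: A + B) = phi c * a A + a B.
  rewrite /a mulr_sumr -big_split; apply: eq_bigr => j _.
  by rewrite !linearP peval_linear mulrDl -mulrA.
have ainj : injective a.
  move=> A B AB; apply/eqP; rewrite -subr_eq0; apply/eqP.
  have aAB : a (A - B) = 0.
    by rewrite addrC -scaleN1r alin AB rmorphN rmorph1 mulN1r addNr.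
  apply/row_matrixP => j; rewrite row0; apply: (can_inj rVpolyK); rewrite linear0.
  apply: contrapT => /eqP h; apply: bfree.
  exists (fun j => rVpoly (row j (A - B)) * g j).
    by exists j; rewrite mulf_neq0 //; case: (gP j).
  by rewrite -[RHS]aAB; apply: eq_bigr => i _; rewrite pevalM mulrA.
have fint A : away_int v t (f A).
  move=> w hw wv wt.
  have -> : 0 = M%:Z * w t^-1 + (N'%:Z * w t + D%:Z * w t).
    by rewrite placeV // /M; lia.
  apply: vgeM => //; first by apply: vgeX => //; exact: vge_val.
  apply: vge_sum => // j _; apply: vgeM => //.
    have [->|p0] := eqVneq (rVpoly (row j A)) 0; first by rewrite peval0 vge0.
    have [_ wp] := place_peval hw wt p0; rewrite /vge wp; apply/orP; right.
    have : (size (rVpoly (row j A)) <= N'.+1)%N by apply: size_poly.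
    by move: (size _) => s; nia.
  have [_ /(_ wt)] := CP j w hw; apply: vge_le.
  have := leq_bigmax (F := C) j; rewrite -/D; nia.
have flin c A B : f (c *: A + B) = phi c * f A + f B.
  by rewrite /f alin mulrDr mulrCA.
have [|W dW WP] := @away_int_subspace v hv t vt n dep _ f flin fint M N.
  by rewrite dimvf /dim /= /M /N'; nia.
exists (map a (vbasis W)); split.
- by rewrite (map_inj_uniq ainj) free_uniq // (basis_free (vbasisP W)).
- by rewrite size_map size_tuple.
move=> _ /mapP[A /vbasis_mem AW ->] w hw wv.
suff : vge w 0 (a A).
  by rewrite /vge; have [->|] := eqVneq (a A) 0; rewrite ?(place0 hw).
(* At poles of [t] integrality was imposed through [W]; elsewhere it follows from integrality of the
   [b' j] over F[t]. *)
have [wt|wt] := ltP (w t) 0.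
  have := WP _ AW w hw wv wt; rewrite /f mulrA -exprMn mulfV //.
  by rewrite expr1n mul1r.
have wt0 : vge w 0 t by rewrite /vge wt orbT.
apply: vge_sum => // j _; rewrite -[0]addr0; apply: vgeM => //; first exact: vge_peval.
by have [] := CP j w hw => + _; apply.
Qed.

End RegularInfinite.

(** * Associated polynomials *)

Lemma mulmx2E (L : fieldType) (g h : 'M[L]_2) i j :
  (g *m h) i j = g i 0 * h 0 j + g i 1 * h 1 j.
Proof.
rewrite mxE !big_ord_recl big_ord0 addr0.
by congr (_ + g i _ * h _ j); apply: val_inj.
Qed.

(** * Cocycle identities for the slash operators *)

Section Slash.
Context (R : realType) (F : finFieldType) (K : fieldExtType {fraction {poly F}}).
Context (v : K -> int) (T : Coo_tower R v).
Implicit Types (g h : 'M[Koo T]_2) (z : Omega T).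

Lemma Koo_inD : {morph @Koo_in R F K v T : x y / x + y}.
Proof. by move=> x y; rewrite /Koo_in !rmorphD. Qed.

Lemma det_neq0 g : g \in unitmx -> Koo_in (\det g) != 0.
Proof. by rewrite unitmxE unitfE Koo_in_eq0. Qed.

Lemma autfacM g h z : h \in unitmx ->
  autfac (g *m h) (val z) = autfac g (val (mobius h z)) * autfac h (val z).
Proof.
move=> hu; have := autfac_neq0 z hu; rewrite mobiusE // /mobius_val /autfac.
by rewrite !mulmx2E !Koo_inD !Koo_inM => jh; field.
Qed.

Lemma mobiusM g h z : g \in unitmx -> h \in unitmx ->
  mobius (g *m h) z = mobius g (mobius h z).
Proof.
move=> gu hu; apply: val_inj.
have ghu : g *m h \in unitmx by rewrite unitmx_mul gu.
have := autfac_neq0 (mobius h z) gu; have := autfac_neq0 z ghu.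
rewrite !mobiusE // /mobius_val autfacM // mobiusE // mulf_eq0 negb_or => /andP[_ jh] jg.
rewrite /mobius_val !mulmx2E !Koo_inD !Koo_inM.
set N := _ + Koo_in (g 0 1).
have -> : (Koo_in (g 0 0) * Koo_in (h 0 0) + Koo_in (g 0 1) * Koo_in (h 1 0)) * val z +
    (Koo_in (g 0 0) * Koo_in (h 0 1) + Koo_in (g 0 1) * Koo_in (h 1 1)) =
    N * autfac h (val z).
  by rewrite /N [RHS]mulrDl -[X in _ = X + _]mulrA divfK // /autfac; ring.
by rewrite -mulf_div divff // mulr1.
Qed.

Lemma cfracM g h z : g \in unitmx -> h \in unitmx ->
  cfrac g (val (mobius h z)) = autfac h (val z) ^+ 2 / Koo_in (\det h) *
    (cfrac (g *m h) (val z) - cfrac h (val z)).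
Proof.
move=> gu hu; have d0 := det_neq0 hu; have jh := autfac_neq0 z hu.
have jg := autfac_neq0 (mobius h z) gu.
rewrite /cfrac autfacM // mulmx2E Koo_inD !Koo_inM.
(* This is the lower left entry of gh adj(h) = det(h) g; the terms in [val z] cancel. *)
have E : Koo_in (\det h) * Koo_in (g 1 0) =
    (Koo_in (g 1 0) * Koo_in (h 0 0) + Koo_in (g 1 1) * Koo_in (h 1 0)) *
    autfac h (val z) - Koo_in (h 1 0) *
    (autfac g (val (mobius h z)) * autfac h (val z)).
  have -> : autfac g (val (mobius h z)) * autfac h (val z) =
      Koo_in (g 1 0) * (Koo_in (h 0 0) * val z + Koo_in (h 0 1)) +
      Koo_in (g 1 1) * autfac h (val z).
    by rewrite mobiusE // [autfac g _]/autfac [LHS]mulrDl -mulrA divfK.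
  by rewrite det_mx22 Koo_inB !Koo_inM /autfac; ring.
move: E jg jh d0; set jg := autfac g _; set jh := autfac h _.
set d := Koo_in (\det h) => E jg0 jh0 d0.
apply: (mulfI d0); rewrite [LHS]mulrA E.
by field; rewrite jg0 jh0 d0.
Qed.

Lemma slashM k m f g h z : g \in unitmx -> h \in unitmx ->
  slash k m f (g *m h) z =
  Koo_in (\det h) ^ m * autfac h (val z) ^ (- k) * slash k m f g (mobius h z).
Proof.
move=> gu hu; rewrite /slash mobiusM // autfacM // det_mulmx Koo_inM !expfzMl.
by ring.
Qed.

(** The substitution in [pslash] is that of [cfracM]: it carries the point of [g *m h] at [z] to the
    point of [g] at [mobius h z]. *)
Lemma pslash_horner k m (P : Omega T -> {poly Coo T}) g h z :
  g \in unitmx -> h \in unitmx ->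
  (pslash k m P h z).[cfrac (g *m h) (val z)] =
  Koo_in (\det h) ^ m * autfac h (val z) ^ (- k) *
    (P (mobius h z)).[cfrac g (val (mobius h z))].
Proof.
move=> gu hu; rewrite /pslash hornerZ horner_comp hornerZ hornerD hornerN hornerX hornerC.
by rewrite -cfracM.
Qed.

(** At the point of [g] itself the substituted variable vanishes. *)
Lemma pslash_horner_cfrac k m (P : Omega T -> {poly Coo T}) g z :
  (pslash k m P g z).[cfrac g (val z)] = slash k m (fun z => (P z)`_0) g z.
Proof.
rewrite /pslash hornerZ horner_comp hornerZ hornerD hornerN hornerX hornerC.
by rewrite subrr mulr0 /slash horner_coef0.
Qed.

End Slash.

(** * Separation of polynomials and the two inclusions *)

Section AssociatedPolynomials.
Context (R : realType) (F : finFieldType) (K : fieldExtType {fraction {poly F}}).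
Context (v : K -> int) (hv : is_place v) (T : Coo_tower R v).
Context (G : set 'M[K]_2) (hG : arithmetic_congruence (regular_outside v) G).

Let Gsub : is_subgroup G. Proof. by case: hG. Qed.

Lemma toKoo_unit g : G g -> toKoo T g \in unitmx.
Proof. by case: Gsub => + _ _ _ => /[apply]; rewrite /toKoo map_unitmx. Qed.

Definition lower_unipotent (c : K) : 'M[K]_2 :=
  \matrix_(i, j) (if (i == 1) && (j == 0) then c else (i == j)%:R).

Lemma lower_unipotent_congruence n c : is_ideal (regular_outside v) n -> n c ->
  principal_congruence (regular_outside v) n (lower_unipotent c).
Proof.
move=> [nA n0 _ _] nc.
have A1 : regular_outside v 1 by move=> w hw _; rewrite place1.
have det1 : \det (lower_unipotent c) = 1.
  rewrite det_trig.
    by rewrite !big_ord_recl big_ord0 !mxE /= !mulr1.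
  by apply/is_trig_mxP => -[[|[|i]] hi] [[|[|j]] hj] // _; rewrite mxE.
split; first split.
- by rewrite unitmxE det1 unitr1.
- move=> i j; rewrite mxE; case: ifP => _; first exact: nA.
  by case: (i == j) => //; exact: nA.
- by rewrite det1 invr1.
move=> i j; rewrite !mxE; case: ifP => [/andP[/eqP-> /eqP->]|_].
  by rewrite subr0.
by rewrite subrr.
Qed.

Lemma cfrac_separates (z : Omega T) (p q : {poly Coo T}) :
  (forall g, G g -> p.[cfrac (toKoo T g) (val z)] = q.[cfrac (toKoo T g) (val z)]) ->
  p = q.
Proof.
have [_ _ [n [nid [x0 nx0 x00]] nG]] := hG.
move=> pq; apply/eqP; rewrite -subr_eq0; apply: contraT => pq0.
(* A nonzero [p - q] has fewer than [size (p - q)] roots, so this many elements of A, scaled by [x0]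
   into the ideal [n], suffice. *)
have [s [us ss sA]] := regular_outside_infinite hv (size (p - q)).
pose c a := cfrac (toKoo T (lower_unipotent (a * x0))) (val z).
have lowG a : a \in s -> G (lower_unipotent (a * x0)).
  move=> /sA Aa; apply/nG/lower_unipotent_congruence => //.
  by case: nid => _ _ _; apply.
have K_in_inj : injective (@K_in R F K v T).
  by move=> x y /fmorph_inj /fmorph_inj /fmorph_inj.
have cE a : a \in s -> K_in T (a * x0) * val z + 1 != 0 /\
    c a = K_in T (a * x0) / (K_in T (a * x0) * val z + 1).
  move=> /lowG Ga; have := autfac_neq0 z (toKoo_unit Ga).
  by rewrite /c /cfrac /autfac !mxE /= /Koo_in !rmorph1.
(* The map u -> u / (uz + 1) is injective: after cross-multiplication the terms [x * y * val z]
   cancel. *)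
have cinj : {in s &, injective c}.
  move=> a b sa sb; have [a1 ->] := cE a sa; have [b1 ->] := cE b sb.
  move/eqP; rewrite eqr_div // => /eqP ab.
  apply: (mulIf x00); apply: K_in_inj; move: ab.
  set x := K_in T _; set y := K_in T _ => ab.
  apply: (addrI (x * y * val z)); transitivity (x * (y * val z + 1)); first by ring.
  by rewrite ab; ring.
have : (size (map c s) < size (p - q)%R)%N.
  apply: max_poly_roots => //; last by rewrite map_inj_in_uniq.
  apply/allP => _ /mapP[a sa ->]; rewrite rootE hornerD hornerN.
  by rewrite pq ?subrr //; exact: lowG.
by rewrite size_map ltnNge ss.
Qed.

Context (k : int) (m : int).

(** Since [P] exists, [xget] does not return its default, and two associated polynomials agree at
    all separating points. *)
Lemma assoc_poly_unique f P : is_assoc_poly G k m f P -> P = assoc_poly T G k m f.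
Proof.
move=> fP; have fQ : is_assoc_poly G k m f (assoc_poly T G k m f).
  by apply: xgetPex; exists P.
apply/funext => z; apply: (@cfrac_separates z) => g Gg.
by rewrite -(proj2 fP) // -(proj2 fQ).
Qed.

Lemma calO0 : @calO R F K v T (fun=> 0).
Proof.
split.
  move=> n e e0; exists 0, 1 => z _; rewrite hornerC oner_neq0 horner0 mul0r subr0.
  have -> : Coo_abs (0 : Coo T) = 0 by apply/(nabs_eq0 (completion_abs (Coo_completion T))).
  by rewrite ltW.
by have [_ _ [n nid _]] := hG; exists n.
Qed.

Lemma quasi_modular_assoc l f : quasi_modular T G k m l f ->
  exists2 P, is_assoc_poly G k m f P & forall z, (size (P z) <= l.+1)%N.
Proof.
move=> [->|[j jl [fs [fsO _ fsE]]]].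
  exists (fun=> 0) => [|z]; last by rewrite size_poly0.
  split; last by move=> g _ z; rewrite /slash mulr0 horner0.
  split; last by exists 0%N => z; rewrite size_poly0.
  by move=> i; under eq_fun do rewrite coef0; exact: calO0.
exists (fun z => \poly_(i < j.+1) fs (inord i) z).
  split; first split.
  - move=> i; under eq_fun do rewrite coef_poly.
    by case: (i < j.+1)%N => //; exact: calO0.
  - by exists j.+1 => z; exact: size_poly.
  move=> g Gg z; rewrite fsE // horner_poly.
  by apply: eq_bigr => i _; rewrite inord_val.
by move=> z; apply: leq_trans (size_poly _ _) _.
Qed.

Lemma assoc_poly_weakly_quasi_modular l f : quasi_modular T G k m l f ->
  weakly_quasi_modular_poly T G k m l (assoc_poly T G k m f).
Proof.
move=> /quasi_modular_assoc[P fP sP]; rewrite -(assoc_poly_unique fP).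
split=> //; first by case: fP.
move=> h Gh z; apply: (@cfrac_separates z) => g Gg.
have [_ _ GM GV] := Gsub.
have hu := toKoo_unit Gh; have Gg' := GM _ _ Gg (GV _ Gh).
(* Through this factorization both sides become the value of f | g at [z]. *)
have gE : toKoo T g = toKoo T (g *m invmx h) *m toKoo T h.
  by rewrite /toKoo -map_mxM mulmxKV //; case: Gsub => + _ _ _; apply.
rewrite [in LHS]gE pslash_horner // ?toKoo_unit // -(proj2 fP) //.
by rewrite -slashM ?toKoo_unit // -gE (proj2 fP).
Qed.

Lemma weakly_quasi_modular_poly_assoc l P : weakly_quasi_modular_poly T G k m l P ->
  is_assoc_poly G k m (fun z => (P z)`_0) P.
Proof.
move=> [PO _ PG]; split=> // g Gg z.
by rewrite -pslash_horner_cfrac PG.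
Qed.

Lemma weakly_quasi_modular_poly_quasi_modular l P :
  weakly_quasi_modular_poly T G k m l P ->
  quasi_modular T G k m l (fun z => (P z)`_0).
Proof.
move=> wP; have [_ PE] := weakly_quasi_modular_poly_assoc wP.
case: wP => -[PO _] sP _.
(* An exact depth requires a nonzero top function, so the depth is the largest index whose
   coefficient is not identically zero. If there is none, the function is 0. *)
pose nz (i : 'I_l.+1) := `[< (fun z => (P z)`_i) <> (fun=> 0) >].
have [[i0 nzi0]|no] := pselect (exists i, nz i); last first.
  left; apply: contrapT => ne; apply: no; exists ord0; exact/asboolP.
right; have [d /asboolP nzd dmax] := @arg_maxnP _ i0 nz (fun i => i : nat) nzi0.
exists d; first by rewrite -ltnS.
exists (fun i z => (P z)`_i); split=> // g Gg z.
rewrite PE // (@horner_coef_wide _ d.+1) //.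
apply/leq_sizeP => j dj; have [lj|jl] := leqP l.+1 j.
  by rewrite nth_default // (leq_trans (sP z)).
apply: contrapT => Pj; suff /dmax : nz (Ordinal jl) by move=> /=; lia.
by apply/asboolP => /(congr1 (fun f => f z)).
Qed.

End AssociatedPolynomials.

Theorem theorem2p12 (R : realType) (F : finFieldType)
    (K : fieldExtType {fraction {poly F}}) (hF : constant_field_is_base K)
    (v : K -> int) (hv : is_place v) (T : Coo_tower R v)
    (G : set 'M[K]_2) (hG : arithmetic_congruence (regular_outside v) G)
    (k l : nat) (m : int) :
  [set assoc_poly T G k m f | f in quasi_modular T G k m l] =
    weakly_quasi_modular_poly T G k m l /\
  (forall P : Omega T -> {poly Coo T}, weakly_quasi_modular_poly T G k m l P ->
     quasi_modular T G k m l (fun z => (P z)`_0) /\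
     P = assoc_poly T G k m (fun z => (P z)`_0)).
Proof.
(* The second assertion comes first because it contains one inclusion of the first. *)
have back P : weakly_quasi_modular_poly T G k m l P ->
    quasi_modular T G k m l (fun z => (P z)`_0) /\
    P = assoc_poly T G k m (fun z => (P z)`_0).
  move=> wP; split; first exact: (weakly_quasi_modular_poly_quasi_modular wP).
  exact: (assoc_poly_unique hv hG (weakly_quasi_modular_poly_assoc wP)).
split=> //; apply/seteqP; split=> [_ [f qf <-]|P /back[qP PE]].
  exact: assoc_poly_weakly_quasi_modular.
by rewrite PE; exists (fun z => (P z)`_0).
Qed.
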